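(* Assume $h_A=1$. Let $L/E$ be a finite Galois extension. Then $L/E$ is cyclotomic coradical (with respect to $\rho$) if and only if it is radical, separable and $[L:E]=p^{s}$ for some integer $s\ge 0$.
   Context: Let $q$ be a power of a prime $p$, let $K$ be a global function field with constant field $\mathbb{F}_q$, let $\mathfrak{p}_\infty$ be a fixed place of $K$ and $A=\{x\in K\mid v_{\mathfrak p}(x)\ge 0 \text{ for every place } \mathfrak p\ne \mathfrak p_\infty\}$. The class number of the Dedekind ring $A$ is denoted $h_A$ (so $h_A=1$ means that $A$ is a principal ideal domain). Let $E$ be a finite extension of $K$ and let $\rho\colon A\to E\langle\tau\rangle$, $a\mapsto\rho_a$, be an $A$-Drinfeld module of rank one over $E$, of generic characteristic (its structural map $\delta\colon A\to E$ is the natural embedding); here $\tau$ is the $q$-Frobenius, and $\rho_a$ is also regarded as an $\mathbb{F}_q$-linear polynomial $\rho_a(U)\in E[U]$. All algebraic extensions of $E$ are taken inside a fixed algebraic closure $\overline{K}$ of $K$; any extension $L$ of $E$ is an $A$-module via $a\cdot u=\rho_a(u)$. For an ideal $I$ of $A$, $\rho[I]=\{u\in\overline K\mid \rho_c(u)=0\text{ for all }c\in I\}$, and $\rho[a]=\rho[(a)]$. For $a\in A\setminus\{0\}$, $\lambda_a$ denotes a generator of the cyclic $A$-module $\rho[a]$ (whether $\lambda_a$ lies in an extension of $E$ does not depend on the choice of generator). For an extension $L/E$ put $\mathrm{DrinT}(L/E)=\{u\in L\mid \text{there is } m\in A\setminus\{0\}\text{ with }\rho_m(u)\in E\}$. The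 extension $L/E$ is called radical if $L=E(X)$ for some subset $X\subseteq \mathrm{DrinT}(L/E)$; it is called pure if for every irreducible $m\in A$, $\lambda_m\in L$ implies $\lambda_m\in E$; it is called cyclotomic coradical if it is radical, separable and pure. *)

(* Defs.v *)
From HB Require Import structures.
From mathcomp Require Import all_boot all_order all_algebra all_field.
From mathcomp Require Import boolp classical_sets constructive_ereal.

Set Implicit Arguments.
Unset Strict Implicit.
Unset Printing Implicit Defensive.

Import Order.TTheory GRing.Theory Num.Theory.
Local Open Scope ring_scope.

Section FunctionField.
Variables (F : finFieldType) (K : fieldType) (iF : {rmorphism F -> K}).

(* "K is finite over F(t)" is spelled out as: K is spanned over F(t) by finitely
   many elements, the coefficients being written over a common denominator. *)
Definition finite_over_ratfun (t : K) : Prop :=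
  exists (n : nat) (b : 'I_n -> K), forall z : K,
  exists (c : 'I_n -> {poly F}) (d : {poly F}),
    (map_poly iF d).[t] != 0 /\
    z = \sum_(i < n) (map_poly iF (c i)).[t] / (map_poly iF d).[t] * b i.

Definition global_function_field : Prop :=
  (exists t : K, ~ algebraicOver iF t /\ finite_over_ratfun t) /\
  (forall z : K, algebraicOver iF z -> exists c : F, z = iF c).

(* Each place of K/F corresponds to exactly one normalized valuation
   v : K ->> int U {+oo}, so the valuation itself is used as the place. *)
Record is_place (v : K -> \bar int) : Prop := IsPlace {
  place_pinfty : forall x, v x = +oo%E <-> x = 0;
  place_ninfty : forall x, v x <> -oo%E;
  placeM : forall x y, v (x * y) = (v x + v y)%E;
  placeD : forall x y, (Order.min (v x) (v y) <= v (x + y)%R)%E;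
  place_const : forall c : F, c != 0 -> v (iF c) = 0%E;
  place_normalized : exists x, v x = 1%:E
}.

Variable vinf : K -> \bar int.

Definition regular_outside : {pred K} :=
  fun x => `[< forall v, is_place v -> v <> vinf -> (0 <= v x)%E >].

Lemma regular_outside_subring : subring_closed regular_outside.
Proof.
have vN1 v : is_place v -> v (-1) = 0%E.
  move=> pv; have := place_const pv (c := -1).
  by rewrite rmorphN1 oppr_eq0 oner_eq0; apply.
split=> [|x y /asboolP Ax /asboolP Ay|x y /asboolP Ax /asboolP Ay];
  apply/asboolP => v pv vinfv.
- have := place_const pv (oner_neq0 F); by rewrite rmorph1 => ->.
- apply: le_trans (placeD pv x (- y)).
  rewrite le_min (Ax v pv vinfv) -mulN1r (placeM pv) (vN1 v pv) add0e.
  exact: Ay.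
- by rewrite (placeM pv); apply: adde_ge0; [apply: Ax|apply: Ay].
Qed.

HB.instance Definition _ :=
  GRing.isSubringClosed.Build K regular_outside regular_outside_subring.

Record coordinate_ring := CoordinateRing {
  coord_val :> K;
  _ : coord_val \in regular_outside
}.

HB.instance Definition _ := [isSub for coord_val].
HB.instance Definition _ := [Choice of coordinate_ring by <:].
HB.instance Definition _ := [SubChoice_isSubComNzRing of coordinate_ring by <:].

End FunctionField.

Section CoordinateRingUnits.
Variables (F : finFieldType) (K : fieldType) (iF : {rmorphism F -> K}).
Variable vinf : K -> \bar int.
Notation A := (coordinate_ring iF vinf).

Definition coord_unit : {pred A} :=
  fun x => (val x != 0) && ((val x)^-1 \in regular_outside iF vinf).

Definition coord_inv (x : A) : A :=
  if coord_unit x then insubd x (val x)^-1 else x.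

Lemma coord_mulVx : {in coord_unit, left_inverse 1 coord_inv *%R}.
Proof.
move=> x Ux; apply: val_inj; have /andP[x0 Ax] := Ux.
have vi : val (insubd x (val x)^-1) = (val x)^-1 by exact: insubdK.
rewrite /coord_inv (Ux : coord_unit x = true) rmorphM rmorph1.
by move: vi => /= ->; rewrite mulVf.
Qed.

Lemma coord_unitPl (x y : A) : y * x = 1 -> coord_unit x.
Proof.
move=> /(congr1 val); rewrite rmorphM rmorph1 /= => yx1.
have x0 : val x != 0.
  by apply/eqP => x0; move/eqP: yx1; rewrite x0 mulr0 eq_sym oner_eq0.
apply/andP; split=> //.
suff -> : (val x)^-1 = val y by exact: valP.
by rewrite -[LHS]mul1r -yx1 mulfK.
Qed.

Lemma coord_inv_out : {in [predC coord_unit], coord_inv =1 id}.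
Proof. by move=> x; rewrite inE /coord_inv => /negbTE /= H; rewrite [coord_unit x]H. Qed.

HB.instance Definition _ := GRing.ComNzRing_hasMulInverse.Build A
  coord_mulVx coord_unitPl coord_inv_out.

Lemma coord_mulf_eq0 (x y : A) : x * y = 0 -> (x == 0) || (y == 0).
Proof.
move=> /(congr1 val)/eqP; rewrite rmorphM rmorph0 /= mulf_eq0.
by rewrite -!(inj_eq val_inj) rmorph0.
Qed.

HB.instance Definition _ := GRing.ComUnitRing_isIntegral.Build A coord_mulf_eq0.

End CoordinateRingUnits.

Section Ideals.
Local Open Scope classical_set_scope.
Variable A : idomainType.

Record is_ideal (I : set A) : Prop := IsIdeal {
  ideal0 : I 0;
  idealD : forall x y, I x -> I y -> I (x + y);
  idealM : forall a x, I x -> I (a * x)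
}.

Definition nonzero_ideal (I : set A) : Prop :=
  is_ideal I /\ exists2 x, I x & x != 0.

Definition principal_ideal (a : A) : set A := [set b * a | b in [set: A]].

Definition ideal_class_eq (I J : set A) : Prop :=
  exists a b : A, [/\ a != 0, b != 0 &
    [set a * x | x in I] = [set b * y | y in J]].

(* The ideal class group has exactly h elements. *)
Definition is_class_number (h : nat) : Prop :=
  exists f : 'I_h -> set A, (forall i, nonzero_ideal (f i)) /\
    forall J, nonzero_ideal J -> exists! i, ideal_class_eq (f i) J.

Definition irreducible_elt (m : A) : Prop :=
  [/\ m != 0, m \isn't a GRing.unit &
    forall x y : A, m = x * y -> x \is a GRing.unit \/ y \is a GRing.unit].

(* deg a = dim_{F_q} (A / aA), i.e. #(A / aA) = q ^ deg a; the cardinality is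
   witnessed by a complete system of representatives. *)
Definition is_degree (q : nat) (a : A) (d : nat) : Prop :=
  exists f : 'I_(q ^ d) -> A, forall x : A,
  exists! i, exists y : A, x - f i = a * y.

End Ideals.

(* A polynomial f : {poly E} with coefficients c_i also stands for the element
   \sum_i c_i tau^i of E<tau>.  Addition is that of {poly E}; the product
   follows from tau c = c^q tau. *)
Section Twisted.
Variables (q : nat) (E : fieldType).

Definition tau_mul (f g : {poly E}) : {poly E} :=
  \sum_(i < size f) \sum_(j < size g) (f`_i * g`_j ^+ (q ^ i)) *: 'X^(i + j).

(* \sum_i c_i tau^i  |->  \sum_i c_i U^(q^i) *)
Definition tau_lin (f : {poly E}) : {poly E} :=
  \sum_(i < size f) f`_i *: 'X^(q ^ i).

End Twisted.

Section Drinfeld.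
Variables (F : finFieldType) (K : fieldType) (iF : {rmorphism F -> K}).
Variable vinf : K -> \bar int.
Notation A := (coordinate_ring iF vinf).
Notation q := #|F|.
Variable E : fieldExtType K.
Variable rho : A -> {poly E}.

(* rho is a homomorphism of F_q-algebras A -> E<tau> of generic characteristic
   whose image is not contained in E. *)
Record drinfeld_module : Prop := DrinfeldModule {
  drinD : forall a b, rho (a + b) = rho a + rho b;
  drin1 : rho 1 = 1;
  drinM : forall a b, rho (a * b) = tau_mul q (rho a) (rho b);
  drin_const : forall (c : F) (a : A), val a = iF c -> rho a = (in_alg E (iF c))%:P;
  drin_generic : forall a, (rho a)`_0 = in_alg E (val a);
  drin_nontrivial : exists a, rho a <> (in_alg E (val a))%:P
}.

(* deg_tau (rho_a) = r * deg a for every a <> 0 *)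
Definition drinfeld_rank (r : nat) : Prop :=
  forall a : A, a != 0 -> exists2 d, is_degree q a d & size (rho a) = (r * d).+1.

Section Action.
Variables (R : comNzRingType) (j : E -> R).

Definition drin_act (a : A) (u : R) : R := (map_poly j (tau_lin q (rho a))).[u].

Definition drin_torsion (I : set A) : set R :=
  [set u | forall c, I c -> drin_act c u = 0]%classic.

(* z is a possible choice of lambda_a *)
Definition is_lambda (a : A) (z : R) : Prop :=
  drin_torsion (principal_ideal a) z /\
  forall w, drin_torsion (principal_ideal a) w -> exists b, w = drin_act b z.

End Action.

Section Extension.
Variable L : fieldExtType E.

Definition DrinT : set L :=
  [set u | exists2 m : A, m != 0 & exists e : E, drin_act (in_alg L) m u = in_alg L e]%classic.

(* {subfield L} consists of the intermediate fields of L / E, so the second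
   conjunct says that L = E(X). *)
Definition radical_ext : Prop :=
  exists X : set L, (X `<=` DrinT)%classic /\
    forall M : {subfield L}, (forall x, X x -> x \in M) -> M = fullv :> {vspace L}.

Variables (Kbar : fieldType) (iL : {rmorphism L -> Kbar}).

Definition pure_ext : Prop :=
  forall m : A, irreducible_elt m ->
  forall z : Kbar, is_lambda (iL \o in_alg L) m z ->
    (exists u : L, iL u = z) -> exists e : E, iL (in_alg L e) = z.

Definition cyclotomic_coradical : Prop :=
  [/\ radical_ext, separable 1 {:L} & pure_ext].

End Extension.
End Drinfeld.

(* Main.v *)
Require Import Defs.
From HB Require Import structures.
From mathcomp Require Import all_boot all_order all_algebra all_fingroup.
From mathcomp Require Import all_solvable all_field zify.
From mathcomp Require Import boolp classical_sets constructive_ereal.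

Set Implicit Arguments.
Unset Strict Implicit.
Unset Printing Implicit Defensive.

Import Order.TTheory GRing.Theory Num.Theory.
Local Open Scope ring_scope.

(** Write [act a u] for [rho_a(u)].  Both implications play the A-module action
    against the Galois action on torsion, which commute because [rho] has its
    coefficients in [E].  Since [h_A = 1], [A] is principal, so the annihilator
    of a nonzero point killed by an irreducible [m] is exactly [(m)]
    ([annihilator_irreducible]).

    If [L/E] is radical and pure, let [x] be an automorphism of [L/E] and
    [D = x - 1].  Rank one makes every nonzero [m]-torsion point a generator of
    the [m]-torsion: its multiples are as many as the roots of [rho_m(U)]
    ([irreducible_torsion_lambda]).  By purity the [m]-torsion of [L] is then
    contained in [E], so [D] kills it; peeling off irreducible factors one at a
    time, some power of [D] kills the [a]-torsion of [L], for every nonzero [a]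
    ([pure_torsion_unipotent]).  If [rho_a(u)] is in [E] then [D u] is
    [a]-torsion, so a power of [D] kills [u].  In characteristic [p] a unipotent
    additive map has [p]-power order ([unipotent_iter_pexp]), hence a power
    [x^(p^n)] fixes [u].  An automorphism of prime order other than [p] would
    thus fix a generating set of [L], and Cauchy's theorem shows that the Galois
    group is a [p]-group.

    Conversely, let [[L : E] = p^s] and let a nonzero [u] in [L] generate the
    [m]-torsion.
    An automorphism [x] acts on [u] as some [b] in [A], and [x^(p^s) = 1] says
    that [b^(p^s) - 1 = (b - 1)^(p^s)] kills [u].  As the annihilator of [u] is
    the prime ideal [(m)], already [b - 1] kills [u]: every automorphism fixes
    [u], and [u] is in [E] ([degree_pexp_pure]). *)

(** * Unipotent additive maps in characteristic p *)

Definition displacement (V : zmodType) (s : V -> V) (u : V) := s u - u.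

Section Unipotent.
Variables (R : nzRingType) (p : nat) (s : {additive R -> R}).
Hypothesis charRp : p \in [pchar R].

Lemma displacement_iter m u :
  displacement s (iter m s u) = iter m s (displacement s u).
Proof. by elim: m => //= m <-; rewrite /displacement raddfB. Qed.

(** In the ring of endomorphisms, this follows from
    [(s - 1)^(p^n) = s^(p^n) - 1] and [n <= p^n].  The induction argues on the
    orbit of [u] instead: with [t = s^(p^n)], the vector [x = t u - u] is fixed
    by [s], because [t] fixes [s u - u]; whence [t^p u = u + p x = u]. *)
Lemma unipotent_iter_pexp n u :
  iter n (displacement s) u = 0 -> iter (p ^ n) s u = u.
Proof.
elim: n u => [|n IH] u; first by move=> /= ->; rewrite raddf0.
rewrite iterSr => /IH; set t := iter (p ^ n) s => fixDu.
have tD v w : t (v + w) = t v + t w.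
  by rewrite /t; elim: (p ^ n)%N => //= m ->; rewrite raddfD.
pose x := t u - u.
have fixx : s x = x.
  apply/eqP; rewrite -subr_eq0.
  have -> : s x - x = displacement s (t u) - displacement s u.
    by rewrite /x raddfB /displacement opprD addrACA -opprD.
  by rewrite displacement_iter -/t fixDu subrr.
have t_eq m : iter m t u = u + x *+ m.
  elim: m => [|m IHm]; first by rewrite addr0.
  have -> : iter m.+1 t u = t (u + x *+ m) by rewrite -IHm.
  rewrite tD.
  have -> : t (x *+ m) = x *+ m.
    by rewrite /t; elim: (p ^ n)%N => //= k ->; rewrite raddfMn /= fixx.
  by rewrite -[t u](subrK u) -/x mulrS addrA [x + u]addrC.
have iterM m : iter (m * p ^ n) s u = iter m t u.
  by elim: m => //= m IHm; rewrite mulSn iterD IHm.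
by rewrite expnS iterM t_eq -mulr_natr (pcharf0 charRp) mulr0 addr0.
Qed.

End Unipotent.

(** * Twisted polynomials as additive maps *)

Section TauEval.
Variables (p k q : nat) (E : fieldType) (R : comNzRingType) (j : {rmorphism E -> R}).
Hypotheses (charRp : p \in [pchar R]) (qE : q = (p ^ k)%N).

(** The additive map [u |-> \sum_i f_i u^(q^i)] of the skew polynomial [f], for
    an arbitrary commutative [E]-algebra [R]; [R = {poly E}] is needed as well
    as fields, see [tau_linM]. *)
Definition tau_eval (f : {poly E}) (u : R) : R := (map_poly j (tau_lin q f)).[u].

Lemma tau_evalE n (f : {poly E}) u : (size f <= n)%N ->
  tau_eval f u = \sum_(i < n) j f`_i * u ^+ (q ^ i).
Proof.
move=> lefn; rewrite /tau_eval /tau_lin rmorph_sum horner_sum.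
rewrite (big_ord_widen _ (fun i => (map_poly j (f`_i *: 'X^(q ^ i))).[u]) lefn).
rewrite big_mkcond; apply: eq_bigr => i _.
rewrite map_polyZ map_polyXn hornerZ hornerXn.
by case: ltnP => // /(nth_default 0) ->; rewrite rmorph0 mul0r.
Qed.

Lemma exprD_pexp i (u v : R) : (u + v) ^+ (q ^ i) = u ^+ (q ^ i) + v ^+ (q ^ i).
Proof.
rewrite exprDn_pchar // qE -expnM pnatX pnatE ?(pcharf_prime charRp) //.
by rewrite charRp.
Qed.

Lemma expr_sum_pexp i n (G : 'I_n -> R) :
  (\sum_l G l) ^+ (q ^ i) = \sum_l G l ^+ (q ^ i).
Proof.
apply: (big_morph (fun u => u ^+ (q ^ i)) (exprD_pexp i)).
by rewrite expr0n qE -expnM expn_eq0 eqn0Ngt prime_gt0 ?(pcharf_prime charRp).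
Qed.

Lemma tau_evalDr f u v : tau_eval f (u + v) = tau_eval f u + tau_eval f v.
Proof.
rewrite !(tau_evalE _ (leqnn _)) -big_split; apply: eq_bigr => i _.
by rewrite exprD_pexp mulrDr.
Qed.

Lemma tau_evalDl (f g : {poly E}) u :
  tau_eval (f + g) u = tau_eval f u + tau_eval g u.
Proof.
have lef := leq_maxl (size f) (size g); have leg := leq_maxr (size f) (size g).
rewrite (tau_evalE u lef) (tau_evalE u leg) (tau_evalE u (size_polyD f g)).
rewrite -big_split.
by apply: eq_bigr => i _; rewrite coefD rmorphD mulrDl.
Qed.

Lemma tau_eval0l u : tau_eval 0 u = 0.
Proof. by rewrite (@tau_evalE 0) ?size_poly0 // big_ord0. Qed.

Lemma tau_evalC c u : tau_eval c%:P u = j c * u.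
Proof. by rewrite (tau_evalE _ (size_polyC_leq1 c)) big_ord1 coefC. Qed.

Lemma tau_evalZXn c i u : tau_eval (c *: 'X^i) u = j c * u ^+ (q ^ i).
Proof.
have le : (size (c *: 'X^i : {poly E}) <= i.+1)%N.
  by rewrite -(size_polyXn E) size_scale_leq.
rewrite (tau_evalE _ le) (bigD1 ord_max) //= big1 => [|l neq].
  by rewrite coefZ coefXn eqxx mulr1 addr0.
by rewrite coefZ coefXn (negbTE (neq : l != i :> nat)) mulr0 rmorph0 mul0r.
Qed.

(** The skew product encodes composition because [u |-> u^(q^i)] is a ring
    endomorphism of [R], so that it can be moved across the inner sum. *)
Lemma tau_evalM (f g : {poly E}) u :
  tau_eval (tau_mul q f g) u = tau_eval f (tau_eval g u).
Proof.
have evD := big_morph (tau_eval^~ u) (fun f g => tau_evalDl f g u) (tau_eval0l u).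
rewrite /tau_mul evD (tau_evalE _ (leqnn (size f))); apply: eq_bigr => i _.
rewrite evD (tau_evalE _ (leqnn (size g))) expr_sum_pexp mulr_sumr.
apply: eq_bigr => l _.
by rewrite tau_evalZXn exprMn -exprM rmorphM rmorphXn /= mulrA -expnD addnC.
Qed.

End TauEval.

Lemma rmorph_tau_eval q (E : fieldType) (R S : comNzRingType)
    (j : {rmorphism E -> R}) (g : {rmorphism R -> S})
    (j' : {rmorphism E -> S}) f u :
  g \o j =1 j' -> g (tau_eval q j f u) = tau_eval q j' f (g u).
Proof.
move=> gj; rewrite /tau_eval -horner_map -map_poly_comp.
by congr horner; apply: eq_map_poly.
Qed.

Section TauLin.
Variables (p k q : nat) (E : fieldType).
Hypotheses (charEp : p \in [pchar E]) (k_gt0 : (0 < k)%N) (qE : q = (p ^ k)%N).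

Lemma q_gt1 : (1 < q)%N.
Proof. by rewrite qE -(exp1n k) ltn_exp2r // prime_gt1 ?(pcharf_prime charEp). Qed.

Lemma tau_lin_eval (f : {poly E}) : tau_lin q f = tau_eval q polyC f 'X.
Proof. by rewrite /tau_eval -/(comp_poly _ _) comp_polyXr. Qed.

(** This is [tau_evalM] at the generic point [U] of [E[U]]. *)
Lemma tau_linM (f g : {poly E}) :
  tau_lin q (tau_mul q f g) = tau_lin q f \Po tau_lin q g.
Proof.
by rewrite tau_lin_eval (@tau_evalM p k) ?pchar_poly // -tau_lin_eval.
Qed.

Lemma size_tau_lin (f : {poly E}) :
  f != 0 -> size (tau_lin q f) = (q ^ (size f).-1).+1.
Proof.
move=> f0; rewrite /tau_lin; move: (lead_coef_eq0 f); rewrite /lead_coef.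
case: (size f) (size_poly_eq0 f) => [|n] /=; first by rewrite eqxx (negbTE f0).
move=> _ fn; rewrite big_ord_recr /= addrC size_polyDl.
  by rewrite size_scale ?fn // size_polyXn.
rewrite size_scale ?fn // size_polyXn ltnS.
apply: leq_trans (size_sum _ _ _) _; apply/bigmax_leqP => i _.
apply: leq_trans (size_scale_leq _ _) _.
by rewrite size_polyXn ltn_exp2l // q_gt1.
Qed.

(** The degree in [tau] is additive because the degree of the associated
    polynomial, a power of [q], is multiplicative under composition. *)
Lemma size_tau_mul (f g h : {poly E}) : f != 0 -> g != 0 -> h != 0 ->
  h = tau_mul q f g -> (size h).-1 = ((size f).-1 + (size g).-1)%N.
Proof.
move=> f0 g0 h0 /(congr1 (fun r => (size (tau_lin q r)).-1)).
rewrite tau_linM size_comp_poly !size_tau_lin //= -expnD => /eqP.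
by rewrite eqn_exp2l ?q_gt1 // => /eqP.
Qed.

End TauLin.

(** * Class number one, units and irreducible elements *)

Section PrincipalIdeals.
Variable A : idomainType.

Lemma scale_principal_ideal (a c : A) :
  [set a * x | x in principal_ideal c]%classic = principal_ideal (a * c) :> set A.
Proof.
apply/seteqP; split=> [_ [_ [b _ <-] <-]|_ [b _ <-]] /=.
  by exists b; rewrite // mulrCA.
by exists (b * c); [exists b|rewrite mulrCA].
Qed.

Lemma principal_of_scale (J : set A) (a c : A) : a != 0 ->
  [set a * x | x in J]%classic = principal_ideal c ->
  exists c', J = principal_ideal c'.
Proof.
move=> a0 aJ.
have [x Jx xa] : [set a * x | x in J]%classic c.
  by rewrite aJ; exists 1; rewrite ?mul1r.
exists x; apply/seteqP; split=> y.
  move=> Jy; have : principal_ideal c (a * y) by rewrite -aJ; exists y.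
  by case=> b _ /=; rewrite -xa mulrCA => /(mulfI a0) <-; exists b.
case=> b _ <- /=.
have : [set a * x | x in J]%classic (b * c) by rewrite aJ; exists b.
by case=> z Jz; rewrite -xa mulrCA => /(mulfI a0) <-.
Qed.

Lemma nonzero_ideal1 : nonzero_ideal (principal_ideal (1 : A)).
Proof.
split; last by exists 1; [exists 1; rewrite ?mulr1|exact: oner_neq0].
split=> [|_ _ [x _ <-] [y _ <-]|a _ [x _ <-]].
- by exists 0; rewrite ?mul0r.
- by exists (x + y); rewrite ?mulrDl.
- by exists (a * x); rewrite ?mulrA.
Qed.

(** The unit ideal shows that the representative of the only class is
    principal, and then so is every ideal of that class. *)
Lemma class_number1_principal (I : set A) :
  is_class_number A 1 -> nonzero_ideal I -> exists c, I = principal_ideal c.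
Proof.
case=> f [_ f_rep].
have f0 J : nonzero_ideal J -> ideal_class_eq (f ord0) J.
  by move=> /f_rep[i [fi _]]; rewrite (ord1 i) in fi.
have [c fc] : exists c, f ord0 = principal_ideal c.
  have [a [b [a0 b0 ab]]] := f0 _ nonzero_ideal1.
  apply: (@principal_of_scale _ a (b * 1) a0).
  by rewrite ab scale_principal_ideal.
move=> I_ideal; have [a [b [a0 b0 ab]]] := f0 _ I_ideal.
apply: (@principal_of_scale _ b (a * c) b0).
by rewrite -ab fc scale_principal_ideal.
Qed.

(** If [A / aA] has one element then [0] and [1] are congruent modulo [a]. *)
Lemma degree0_unit (q : nat) (a : A) : is_degree q a 0 -> a \is a GRing.unit.
Proof.
case=> f res; have [i0 [[y0 e0] _]] := res 0; have [i1 [[y1 e1] _]] := res 1.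
have i01 : i1 = i0.
  have ord_q0 (i : 'I_(q ^ 0)) : i = 0%N :> nat.
    by apply/eqP; have := ltn_ord i; rewrite {2}expn0 ltnS leqn0.
  by apply: ord_inj; rewrite !ord_q0.
have inv_a : a * (y1 - y0) = 1.
  by rewrite mulrBr -e0 -e1 i01 opprB subr0 subrK.
by apply/unitrP; exists (y1 - y0); rewrite mulrC inv_a.
Qed.

Lemma reducible_factor (a : A) :
  a != 0 -> a \isn't a GRing.unit -> ~ irreducible_elt a ->
  exists x y, [/\ a = x * y, x \isn't a GRing.unit & y \isn't a GRing.unit].
Proof.
move=> a0 aU; apply: contra_notP => /forallNP noxy; split=> // x y axy.
have [xU|xU] := boolP (x \is a GRing.unit); first by left.
have [yU|yU] := boolP (y \is a GRing.unit); first by right.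
by case: (noxy x); exists y.
Qed.

End PrincipalIdeals.

(** * The action of A through a Drinfeld module *)

Section Action.
Variables (p k : nat) (F : finFieldType).
Variables (K : fieldType) (iF : {rmorphism F -> K}).
Variables (vinf : K -> \bar int) (E : fieldExtType K).
Notation A := (coordinate_ring iF vinf).
Notation q := #|F|.
Variable rho : A -> {poly E}.
Hypotheses (p_pr : prime p) (k_gt0 : (0 < k)%N) (cardF : q = (p ^ k)%N).
Hypothesis (drin : drinfeld_module rho).

Lemma pchar_const : p \in [pchar F].
Proof. exact: card_finPcharP cardF p_pr. Qed.

Lemma pchar_base : p \in [pchar E].
Proof. exact/(rmorph_pchar (in_alg E))/(rmorph_pchar iF)/pchar_const. Qed.

Lemma pchar_coord : p \in [pchar A].
Proof.
rewrite inE p_pr -(inj_eq val_inj) rmorph_nat rmorph0 -(rmorph_nat iF).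
by rewrite (pcharf0 pchar_const) rmorph0 eqxx.
Qed.

Lemma drin_size (a b : A) : drinfeld_rank rho 1 -> a != 0 -> b != 0 ->
  (size (rho (a * b))).-1 = ((size (rho a)).-1 + (size (rho b)).-1)%N.
Proof.
move=> rk a0 b0; have rho_neq0 c : c != 0 -> rho c != 0.
  by move=> /rk[d _ sz]; rewrite -size_poly_gt0 sz.
apply: (size_tau_mul pchar_base k_gt0 cardF); rewrite ?rho_neq0 ?mulf_neq0 //.
exact: drinM.
Qed.

Section Module.
Variables (R : comNzRingType) (j : {rmorphism E -> R}).

Lemma pchar_target : p \in [pchar R].
Proof. exact/(rmorph_pchar j)/pchar_base. Qed.

Local Notation act := (drin_act rho j).

Lemma actDl a b u : act (a + b) u = act a u + act b u.
Proof. by rewrite /drin_act (drinD drin) -!/(tau_eval q j _ _) tau_evalDl. Qed.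

Lemma actDr a u v : act a (u + v) = act a u + act a v.
Proof. exact: tau_evalDr pchar_target cardF _ _ _. Qed.

Lemma actM a b u : act (a * b) u = act a (act b u).
Proof.
rewrite /drin_act (drinM drin) -!/(tau_eval q j _ _).
exact: (tau_evalM _ pchar_target cardF).
Qed.

Lemma act1 u : act 1 u = u.
Proof.
rewrite /drin_act (drin1 drin) -/(tau_eval q j 1%:P _).
by rewrite tau_evalC rmorph1 mul1r.
Qed.

Lemma act0l u : act 0 u = 0.
Proof. by apply: (addrI (act 0 u)); rewrite -actDl !addr0. Qed.

Lemma act0r a : act a 0 = 0.
Proof. by apply: (addrI (act a 0)); rewrite -actDr !addr0. Qed.

Lemma actBl a b u : act (a - b) u = act a u - act b u.
Proof. by apply/eqP; rewrite eq_sym subr_eq -actDl subrK. Qed.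

Lemma actBr a u v : act a (u - v) = act a u - act a v.
Proof. by apply/eqP; rewrite eq_sym subr_eq -actDr subrK. Qed.

Lemma act_unit_eq0 a u : a \is a GRing.unit -> act a u = 0 -> u = 0.
Proof. by move=> aU au0; rewrite -[u]act1 -(mulVr aU) actM au0 act0r. Qed.

Lemma torsion_principalP m u :
  drin_torsion rho j (principal_ideal m) u <-> act m u = 0.
Proof.
split=> [|mu0 _ [b _ <-]]; last by rewrite actM mu0 act0r.
by apply; exists 1; rewrite ?mul1r.
Qed.

(** The annihilator of [u] is an ideal containing [m], hence generated by a
    divisor of [m]; that divisor is no unit as [u] is nonzero, so it is
    associated to [m]. *)
Lemma annihilator_irreducible m u c : is_class_number A 1 -> irreducible_elt m ->
  act m u = 0 -> u != 0 -> act c u = 0 -> exists y, c = m * y.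
Proof.
move=> cl [m0 mU m_irr] mu0 u0 cu0.
have [e Ie] : exists e, [set a | act a u = 0]%classic = principal_ideal e.
  apply: class_number1_principal => //; split; last by exists m.
  split=> [|x y /= xu yu|a x /= xu]; first exact: act0l.
    by rewrite actDl xu yu addr0.
  by rewrite actM xu act0r.
have : principal_ideal e e by exists 1; rewrite ?mul1r.
rewrite -{1}Ie /= => eu0.
have : principal_ideal e m by rewrite -Ie.
case=> x _ xe; case: (m_irr x e (esym xe)) => [xU|eU]; last first.
  by rewrite (act_unit_eq0 eU eu0) eqxx in u0.
have : principal_ideal e c by rewrite -Ie.
case=> b _ <-; exists (b / x).
by rewrite [RHS]mulrCA -xe [x * e]mulrC mulrK.
Qed.

End Module.

Lemma rmorph_act (R S : comNzRingType) (j : {rmorphism E -> R})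
    (g : {rmorphism R -> S}) (j' : {rmorphism E -> S}) a u :
  g \o j =1 j' -> g (drin_act rho j a u) = drin_act rho j' a (g u).
Proof. exact: rmorph_tau_eval. Qed.

(** The annihilator of [u] is [(m)], so the [q^d] elements of [A / (m)] give
    [q^d] distinct multiples of [u]; as [rho] has rank one, [rho_m(U)] has degree
    [q^d], and these multiples are all its roots. *)
Lemma irreducible_torsion_lambda (R : idomainType) (j : {rmorphism E -> R}) m u :
  is_class_number A 1 -> drinfeld_rank rho 1 ->
  irreducible_elt m -> drin_act rho j m u = 0 -> u != 0 -> is_lambda rho j m u.
Proof.
move=> cl rk m_irr mu0 u0; have [m0 _ _] := m_irr.
split; first exact/torsion_principalP.
move=> w /torsion_principalP mw0.
have [d [f res] szm] := rk m m0.
pose P := map_poly j (tau_lin q (rho m)).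
have rhom0 : rho m != 0 by rewrite -size_poly_gt0 szm.
have szP : size P = (q ^ d).+1.
  by rewrite size_map_poly (size_tau_lin pchar_base k_gt0 cardF) // szm mul1n.
have root_torsion v : drin_act rho j m v = 0 -> root P v.
  by move=> mv0; apply/eqP.
pose s := [seq drin_act rho j (f i) u | i : 'I_(q ^ d)].
have [/mapP[i _ ->]|ws] := boolP (w \in s); first by exists (f i).
suff : (size (w :: s) < size P)%N by rewrite szP /= size_map size_enum_ord ltnn.
apply: max_poly_roots; first by rewrite -size_poly_gt0 szP.
  rewrite /= root_torsion //; apply/allP => _ /mapP[i _ ->].
  by apply: root_torsion; rewrite -actM mulrC actM mu0 act0r.
rewrite /= ws map_inj_uniq ?enum_uniq // => i i' /eqP.
rewrite -subr_eq0 -actBl => /eqP.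
move=> /(annihilator_irreducible cl m_irr mu0 u0)[y fy].
have [l [_ l_uniq]] := res (f i).
rewrite -(l_uniq i); first by apply: l_uniq; exists y.
by exists 0; rewrite subrr mulr0.
Qed.

End Action.

(** * Galois action on torsion *)

Section Galois.
Variables (p k : nat) (F : finFieldType).
Variables (K : fieldType) (iF : {rmorphism F -> K}).
Variables (vinf : K -> \bar int) (E : fieldExtType K).
Notation A := (coordinate_ring iF vinf).
Variable rho : A -> {poly E}.
Hypotheses (p_pr : prime p) (k_gt0 : (0 < k)%N) (cardF : #|F| = (p ^ k)%N).
Hypotheses (drin : drinfeld_module rho) (rk : drinfeld_rank rho 1).
Hypothesis cl : is_class_number A 1.
Variables (L : splittingFieldType E).
Variables (Kbar : fieldType) (iL : {rmorphism L -> Kbar}).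

Local Notation act := (drin_act rho (in_alg L)).

Lemma act_embed a u : iL (act a u) = drin_act rho (iL \o in_alg L) a (iL u).
Proof. exact: rmorph_act. Qed.

Lemma gal_in_alg (x : gal_of {:L}) e : x (in_alg L e) = in_alg L e.
Proof. by rewrite /= linearZ /= rmorph1. Qed.

Lemma gal_act (x : gal_of {:L}) a u : x (act a u) = act a (x u).
Proof. by apply: rmorph_act => e; apply: gal_in_alg. Qed.

Lemma gal_iter (x : gal_of {:L}) n u : (x ^+ n)%g u = iter n x u.
Proof.
elim: n => [|n IH]; first by rewrite gal_id.
by rewrite expgSr galM ?memvf // IH.
Qed.

Lemma pure_torsion_base m u : pure_ext rho iL ->
  irreducible_elt m -> act m u = 0 -> exists e, u = in_alg L e.
Proof.
move=> pureL m_irr mu0.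
have [->|u0] := eqVneq u 0; first by exists 0; rewrite rmorph0.
have lam : is_lambda rho (iL \o in_alg L) m (iL u).
  apply: (irreducible_torsion_lambda p_pr k_gt0 cardF) => //.
    by rewrite -act_embed mu0 rmorph0.
  by rewrite fmorph_eq0.
have [e /fmorph_inj <-] := pureL m m_irr _ lam (ex_intro _ u erefl).
by exists e.
Qed.

(** Induction on the degree of [a], which drops in a proper factorization
    [a = y * z]: if [act z u] is killed by [D^ny], where [D] is the displacement
    of [x], then [D^ny u] is [z]-torsion, as [D] commutes with [act z]. *)
Lemma pure_torsion_unipotent (x : gal_of {:L}) a : pure_ext rho iL -> a != 0 ->
  exists n, forall u, act a u = 0 -> iter n (displacement x) u = 0.
Proof.
move=> pureL; have [N] := ubnP (size (rho a)); elim: N a => // N IH a ltN a0.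
have [aU|aU] := boolP (a \is a GRing.unit).
  by exists 0 => u; apply: (act_unit_eq0 p_pr cardF drin).
have [a_irr|/(reducible_factor a0 aU)] := pselect (irreducible_elt a).
  exists 1%N => u /(pure_torsion_base pureL a_irr)[e ->] /=.
  by rewrite /displacement gal_in_alg subrr.
have size_gt0 c : c \isn't a GRing.unit -> c != 0 -> (0 < (size (rho c)).-1)%N.
  move=> cU /rk[d deg ->]; rewrite mul1n lt0n; apply: contraNneq cU => d0.
  by apply: (@degree0_unit _ #|F|); rewrite -d0.
case=> y [z [ayz yU zU]]; move: a0; rewrite ayz mulf_eq0 negb_or => /andP[y0 z0].
have := drin_size p_pr k_gt0 cardF drin rk y0 z0; rewrite -ayz => sz.
have [ly lz] : (size (rho y) < N)%N /\ (size (rho z) < N)%N.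
  have := size_gt0 y yU y0; have := size_gt0 z zU z0; lia.
have [ny killy] := IH y ly y0; have [nz killz] := IH z lz z0.
exists (nz + ny)%N => u; rewrite ayz (actM p_pr cardF drin) => /killy yzu.
rewrite iterD; apply: killz; rewrite -yzu.
elim: ny {killy yzu} => //= n <-.
by rewrite /displacement (actBr rho p_pr cardF) gal_act.
Qed.

(** If [act m u] lies in [E], then [x u - u] is [m]-torsion, so one more
    displacement than for the [m]-torsion kills [u]. *)
Lemma pure_radical_fixed (x : gal_of {:L}) u : pure_ext rho iL ->
  DrinT rho u -> exists n, (x ^+ (p ^ n))%g u = u.
Proof.
move=> pureL [m m0 [e mu]].
have [n kill] := pure_torsion_unipotent x pureL m0.
exists n.+1; rewrite gal_iter; apply: unipotent_iter_pexp.
  exact: (pchar_target iF p_pr cardF (in_alg L)).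
rewrite iterSr; apply: kill.
by rewrite /displacement (actBr rho p_pr cardF) -gal_act mu gal_in_alg subrr.
Qed.

Lemma pure_radical_pgroup : radical_ext rho L -> pure_ext rho iL ->
  pgroup p 'Gal({:L} / 1).
Proof.
case=> X [sXT genX] pureL; apply/pgroupP => l l_pr /Cauchy[//|x _ ordx].
apply: contraT => neq_lp.
suff x1 : x = 1%g by rewrite -ordx x1 order1 in l_pr.
apply/eqP/gal_eqP => u _; rewrite gal_id.
have fixX v : X v -> v \in fixedField [set x].
  move=> /sXT/(pure_radical_fixed x pureL)[n fixv].
  apply/fixedFieldP => [|_ /set1P->]; first exact: memvf.
  (* [p ^ n] is prime to the order of [x], so [x] is a power of [x ^+ (p ^ n)] *)
  have : x \in <[x ^+ (p ^ n)]>%g.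
    have -> : <[x ^+ (p ^ n)]>%g = <[x]>%g.
      apply/esym/eqP; rewrite -/(generator _ _) generator_coprime ordx.
      by apply: coprimeXr; rewrite prime_coprime // dvdn_prime2.
    exact: cycle_id.
  case/cycleP=> i ->; rewrite gal_iter.
  by elim: i => //= i ->.
have := genX [aspace of fixedField [set x]] fixX => fixL.
have : u \in fixedField [set x] by rewrite fixL memvf.
by case/mem_fixedFieldP => _; apply; rewrite set11.
Qed.

(** Equivalently, the [p]-group of automorphisms acts on the one-dimensional
    [A / (m)]-space of [m]-torsion through [(A / (m))^*], where [b^(p^s) = 1]
    forces [b = 1] since the residue field has characteristic [p]. *)
Lemma degree_pexp_pure s : galois 1 {:L} -> \dim {:L} = (p ^ s)%N ->
  pure_ext rho iL.
Proof.
move=> galL dimL m m_irr z.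
move=> [/(torsion_principalP p_pr cardF drin) mz0 gen_z] [u uz].
rewrite -{z}uz in mz0 gen_z *.
have mu0 : act m u = 0 by apply: (fmorph_inj iL); rewrite act_embed mz0 rmorph0.
have [->|u0] := eqVneq u 0; first by exists 0; rewrite !rmorph0.
suff : u \in fixedField 'Gal({:L} / 1)%g.
  by rewrite (galois_fixedField _) // => /vlineP[e ->]; exists e.
apply/fixedFieldP => [|x Gx]; first exact: memvf.
have [b xu] : exists b, x u = act b u.
  have [|b xu] := gen_z (iL (x u)); last first.
    by exists b; apply: (fmorph_inj iL); rewrite act_embed.
  apply/(torsion_principalP p_pr cardF drin).
  by rewrite -act_embed -gal_act mu0 !rmorph0.
have iter_x n : (x ^+ n)%g u = act (b ^+ n) u.
  rewrite gal_iter; elim: n => [|n IH] /=; first by rewrite (act1 drin).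
  by rewrite IH gal_act xu -(actM p_pr cardF drin) -exprSr.
have ps_kill : act ((b - 1) ^+ (p ^ s)) u = 0.
  have -> : (b - 1) ^+ (p ^ s) = b ^+ (p ^ s) - 1.
    have ps_nat : [pchar A].-nat (p ^ s)%N.
      by rewrite pnatX pnatE // (pchar_coord iF vinf p_pr cardF).
    by rewrite exprDn_pchar // exprNn_pchar // expr1n.
  rewrite (actBl drin) -iter_x (act1 drin).
  have -> : (p ^ s)%N = #|'Gal({:L} / 1)%g|.
    by rewrite -galois_dim // dimv1 divn1.
  by rewrite expg_cardG // gal_id subrr.
suff : act (b - 1) u = 0.
  by rewrite (actBl drin) (act1 drin) -xu => /eqP; rewrite subr_eq0 => /eqP.
(* otherwise [b - 1] acts injectively on multiples of [u], and so do its powers *)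
apply: contrapT => /eqP c0.
have : act ((b - 1) ^+ (p ^ s)) u != 0.
  elim: (p ^ s)%N => [|n IH]; first by rewrite (act1 drin).
  apply: contra_neq c0; rewrite exprS (actM p_pr cardF drin) => cn0.
  have mn0 : act m (act ((b - 1) ^+ n) u) = 0.
    rewrite -(actM p_pr cardF drin) mulrC (actM p_pr cardF drin) mu0.
    exact: (act0r rho p_pr cardF).
  have [y ->] := annihilator_irreducible p_pr cardF drin cl m_irr mn0 IH cn0.
  by rewrite mulrC (actM p_pr cardF drin) mu0 (act0r rho p_pr cardF).
by rewrite ps_kill eqxx.
Qed.

End Galois.

Theorem theorem5p9
  (p k q : nat) (hp : prime p) (hk : (0 < k)%N) (hq : q = (p ^ k)%N)
  (F : finFieldType) (hF : #|F| = q)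
  (K : fieldType) (iF : {rmorphism F -> K}) (hK : global_function_field iF)
  (vinf : K -> \bar int) (hvinf : is_place iF vinf)
  (hA : is_class_number (coordinate_ring iF vinf) 1)
  (E : fieldExtType K)
  (rho : coordinate_ring iF vinf -> {poly E})
  (hrho : drinfeld_module rho) (hrank : drinfeld_rank rho 1)
  (L : splittingFieldType E) (hL : galois 1 {:L})
  (* an algebraic closure of K containing L, hence E *)
  (Kbar : closedFieldType) (iL : {rmorphism L -> Kbar})
  (hKbar : forall z : Kbar, algebraicOver (iL \o in_alg L \o in_alg E) z) :
  cyclotomic_coradical rho iL <->
  [/\ radical_ext rho L, separable 1 {:L} & exists s : nat, \dim {:L} = (p ^ s)%N].
Proof.
have cardF : #|F| = (p ^ k)%N by rewrite hF.
split=> [[radL sepL pureL]|[radL sepL [s dimL]]]; split=> //.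
  have /p_natP[s cardG] := pure_radical_pgroup hp hk cardF hrho hrank hA radL pureL.
  by exists s; rewrite -cardG -galois_dim // dimv1 divn1.
exact: (degree_pexp_pure hp cardF hrho hA hL dimL).
Qed.
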